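(* Let $\mathbb{D}=\{z\in\mathbb{C}:|z|<1\}$. Suppose that $f(z)=\sum_{n=0}^{\infty}a_nz^n$ is analytic in $\mathbb{D}$ with $|f(z)|\le 1$ for all $z\in\mathbb{D}$. Let $f_0(z)=f(z)-a_0$, let $\|f_0\|_r^2=\sum_{n=1}^{\infty}|a_n|^2r^{2n}$, and let $S_r$ denote the area of the image of the subdisk $|z|<r$ under $f$. Then $$|a_0|^2+\sum_{n=1}^{\infty}|a_n|r^n+\left(\frac{1}{1+|a_0|}+\frac{r}{1-r}\right)\|f_0\|_r^2+\frac{9}{8}\left(\frac{S_r}{\pi}\right)+\mu\left(\frac{S_r}{\pi}\right)^2\le 1\quad\text{for } 0\le r\le\frac{1}{3-|a_0|},$$ where $$\mu=\frac{-80919+119556a_{**}-57591a_{**}^2+11664a_{**}^3-1620a_{**}^4}{8(a_{**}+1)^2(a_{**}-3)^3\left(9a_{**}^3-33a_{**}^2+29a_{**}-1\right)}=13.966088\cdots$$ and $a_{**}\approx 0.638302$ is the unique root in $(0,1)$ of the equation $\phi(t)=0$, where $$\phi(t)=-1296t^8+17172t^7-154386t^6+798660t^5-2361960t^4+4132944t^3-4244238t^2+2344464t-524880.$$ Equality in the inequality $$|a_0|^2+\sum_{n=1}^{\infty}|a_n|r^n+\left(\frac{1}{1+|a_0|}+\frac{r}{1-r}\right)\|f_0\|_r^2+\frac{9}{8}\left(\frac{S_r}{\pi}\right)+\mu\left(\frac{S_r}{\pi}\right)^2\le 1$$ is achieved for the function $f(z)=\frac{a-z}{1-az}$ with $a=a_{**}$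 and $r=\frac{1}{3-a_{**}}$.
   Context: The area $S_r$ of the image of $\{|z|<r\}$ under $f$ is counted with multiplicity, i.e. $\frac{S_r}{\pi}=\sum_{n=1}^{\infty}n|a_n|^2r^{2n}$.
   Formalization: The printed value μ = 13.966088⋯ is not correct for the exact root a_** (the formula gives μ ≈ 13.9660865); the formal statement instead asserts |μ − 13.966088| ≤ 2·10⁻⁶. *)

(* Defs.v *)
From Stdlib Require Export Reals.
From Coquelicot Require Export Coquelicot.
Open Scope R_scope.

(* Analyticity on the open unit disk is expressed by the (necessarily unique)
   power series expansion at the origin, [f z = sum_n a_n z^n] for [|z| < 1].
   For such [a] all the real series below converge whenever [0 <= r < 1], so
   [Series] always denotes a genuine sum there. *)
Definition disk_expansion (f : C -> C) (a : nat -> C) : Prop :=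
  forall z : C, Cmod z < 1 -> @is_pseries C_AbsRing C_NormedModule a z (f z).

Definition bounded_on_disk (f : C -> C) : Prop :=
  forall z : C, Cmod z < 1 -> Cmod (f z) <= 1.

(* All sums over [n >= 1] are reindexed by [n = S k]. *)
Definition majorant0 (a : nat -> C) (r : R) : R :=
  Series (fun k => Cmod (a (S k)) * r ^ S k).

(* [||f_0||_r^2] for [f_0 = f - a_0]. *)
Definition norm0_sq (a : nat -> C) (r : R) : R :=
  Series (fun k => Cmod (a (S k)) ^ 2 * r ^ (2 * S k)).

(* Area of the image of [|z| < r], counted with multiplicity:
   [S_r = pi * sum_(n >= 1) n |a_n|^2 r^(2n)]. *)
Definition image_area (a : nat -> C) (r : R) : R :=
  PI * Series (fun k => INR (S k) * Cmod (a (S k)) ^ 2 * r ^ (2 * S k)).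

Definition bohr_lhs (mu : R) (a : nat -> C) (r : R) : R :=
  Cmod (a 0%nat) ^ 2 + majorant0 a r
  + (1 / (1 + Cmod (a 0%nat)) + r / (1 - r)) * norm0_sq a r
  + 9 / 8 * (image_area a r / PI)
  + mu * (image_area a r / PI) ^ 2.

Definition phi (t : R) : R :=
  - 1296 * t ^ 8 + 17172 * t ^ 7 - 154386 * t ^ 6 + 798660 * t ^ 5
  - 2361960 * t ^ 4 + 4132944 * t ^ 3 - 4244238 * t ^ 2 + 2344464 * t
  - 524880.

(* At the root 0.63830206... of [phi] in (0, 1) this is 13.9660865...;
   the rounded argument 0.638302 gives 13.966088... instead. *)
Definition mu_of (t : R) : R :=
  (- 80919 + 119556 * t - 57591 * t ^ 2 + 11664 * t ^ 3 - 1620 * t ^ 4)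
  / (8 * (t + 1) ^ 2 * (t - 3) ^ 3 * (9 * t ^ 3 - 33 * t ^ 2 + 29 * t - 1)).

Definition disk_automorphism (t : R) (z : C) : C :=
  ((RtoC t - z) / (1 - RtoC t * z))%C.

(* Main.v *)
Require Import Defs.
From Stdlib Require Import Arith Reals Lra Lia Psatz.
From Coquelicot Require Import Coquelicot.
Open Scope R_scope.

(** Why the theorem holds.  Write [p = |a_0|] and [c = 1 - p^2].  Two sharp
    estimates reduce everything to one real variable:
    - [majorant_bound]: the sum of [|a_n| r^n] plus
      [(1/(1+p) + r/(1-r)) ||f_0||_r^2] is at most [c r/(1-r)];
    - [area_bound]: [S_r/pi <= c^2 r^2 / (1 - p^2 r^2)^2] for [r <= 1/2].
    Both right-hand sides increase with [r], so [r = 1/(3-p)] is the worst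
    case.  There, calling [G] the area bound, the claim becomes
    [(sharp_mu p - mu) G^2 >= 0] for an explicit rational function
    [sharp_mu] ([extremal_identity]): the best constant is the minimum of
    [sharp_mu p] for [0 <= p < 1].  Its derivative is a positive multiple of [phi],
    which changes sign exactly once, at [t]; and [mu_of t] equals
    [sharp_mu t] because their difference is a multiple of [phi t].

    The two estimates come from one source.  Multiplication by a function
    bounded by 1 is a contraction of the Hardy space, and it stays one after
    truncating power series at any order, since a coefficient of a product
    depends on lower coefficients only ([disk_contraction]).  This is obtained
    without integrals: for polynomials, Parseval's identity is a finite sum
    over roots of unity ([parseval_roots], [poly_contraction]); the general
    case follows by truncating on a circle of radius [r < 1] and letting
    [r] tend to 1.

    Testing the contraction on sequences that begin with a prescribed block
    and continue with the optimal multiple of a reversed conjugate block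
    of coefficients gives the [gap_inequality]; two choices of the first
    block yield everything needed:
    - [|a_(n+1)|^2 <= c (1 - |a_0|^2 - .. - |a_n|^2)], hence a bound for the
      partial sums of [|a_n|^2] by those of the disk automorphism, which
      Abel summation with the weights [n r^(2n)] turns into the area bound;
    - Carlson's inequalities for [a_(2n+1)] and [a_(2n)], which sum to the
      majorant bound: each [|a_n|^2] is subtracted once with weight
      [r^(2n)/(1+p)] and once with every [r^k], [k > 2n].

    For [f z = (t - z)/(1 - t z)] all series are geometric and each of these
    estimates is an equality ([mobius_bohr_lhs]). *)

(** * Finite sums *)

(* [sum_n] lands in the carrier of a canonical structure; [ring] needs the
   concrete type. *)
Ltac ring_carrier :=
  match goal with
  | |- @eq _ ?x ?y => first [change (@eq R x y) | change (@eq C x y)]; ring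
  end.

Definition cpoly (a : nat -> C) (n : nat) (z : C) : C :=
  sum_n (fun k => a k * z ^ k)%C n.

Definition conv (a u : nat -> C) (k : nat) : C :=
  sum_n (fun j => u j * a (k - j)%nat)%C k.

Definition energy (u : nat -> C) (n : nat) : R :=
  sum_n (fun k => Cmod (u k) ^ 2) n.

Lemma sum_n_S_C (a : nat -> C) n : sum_n a (S n) = (sum_n a n + a (S n))%C.
Proof. exact (sum_Sn a n). Qed.

Lemma sum_n_S_R (a : nat -> R) n : sum_n a (S n) = sum_n a n + a (S n).
Proof. exact (sum_Sn a n). Qed.

Lemma sum_n_0_C (a : nat -> C) : sum_n a 0 = a 0%nat.
Proof. exact (sum_O a). Qed.

Lemma sum_n_0_R (a : nat -> R) : sum_n a 0 = a 0%nat.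
Proof. exact (sum_O a). Qed.

Lemma sum_n_mult_l_C (c : C) (u : nat -> C) n :
  sum_n (fun k => c * u k)%C n = (c * sum_n u n)%C.
Proof. exact (sum_n_mult_l c u n). Qed.

Lemma sum_n_mult_l_R (c : R) (u : nat -> R) n :
  sum_n (fun k => c * u k) n = c * sum_n u n.
Proof. exact (sum_n_mult_l c u n). Qed.

Lemma sum_n_le_R (a b : nat -> R) n :
  (forall k, (k <= n)%nat -> a k <= b k) -> sum_n a n <= sum_n b n.
Proof.
  induction n as [|n IH]; intros H.
  - rewrite !sum_n_0_R. apply H; lia.
  - rewrite !sum_n_S_R. apply Rplus_le_compat.
    + apply IH; intros; apply H; lia.
    + apply H; lia.
Qed.

Lemma energy_S (u : nat -> C) n : energy u (S n) = energy u n + Cmod (u (S n)) ^ 2.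
Proof. exact (sum_n_S_R _ n). Qed.

Lemma energy_mono (u : nat -> C) n m : (n <= m)%nat -> energy u n <= energy u m.
Proof.
  intros H; induction H as [|m _ IH]; [lra|].
  rewrite energy_S. pose proof (pow2_ge_0 (Cmod (u (S m)))). lra.
Qed.

Lemma energy_nonneg (u : nat -> C) n : 0 <= energy u n.
Proof.
  apply Rle_trans with (energy u 0); [|apply energy_mono; lia].
  unfold energy. rewrite sum_n_0_R. apply pow2_ge_0.
Qed.

Lemma sum_n_split {G : AbelianMonoid} (g : nat -> G) l d :
  sum_n g (l + S d) = plus (sum_n g l) (sum_n (fun i => g (S l + i)%nat) d).
Proof.
  induction d as [|d IH].
  - rewrite Nat.add_1_r, sum_Sn, sum_O. now rewrite Nat.add_0_r.
  - rewrite Nat.add_succ_r, !sum_Sn, IH, <- plus_assoc.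
    now replace (S (l + S d)) with (S l + S d)%nat by lia.
Qed.

Lemma sum_n_rev {G : AbelianMonoid} (g : nat -> G) n :
  sum_n (fun i => g (n - i)%nat) n = sum_n g n.
Proof.
  induction n as [|n IH]; [reflexivity|].
  change (S n) with (0 + S n)%nat at 2.
  rewrite sum_n_split, sum_O, sum_Sn, plus_comm. simpl Nat.add. rewrite Nat.sub_0_r.
  f_equal. rewrite <- IH. reflexivity.
Qed.

Lemma Cmod_RtoC_nonneg x : 0 <= x -> Cmod (RtoC x) = x.
Proof. intros H. rewrite Cmod_R. now apply Rabs_pos_eq. Qed.

(** * Parseval's identity at roots of unity *)

Lemma Cmod_sq_plus (x y : C) :
  Cmod (x + y) ^ 2 = Cmod x ^ 2 + Cmod y ^ 2 + 2 * Re (x * Cconj y).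
Proof. rewrite !Cmod2_alt. destruct x, y. simpl. ring. Qed.

(** With [d] below the order [n + 1], [w^d <> 1] because
    [1 - cos (2 x) = 2 (sin x)^2] and [sin] has no zero strictly between 0
    and [PI]. *)
Lemma primitive_root (n : nat) :
  exists w : C, Cmod w = 1 /\ (w ^ S n = 1)%C
    /\ forall d, (0 < d <= n)%nat -> (w ^ d)%C <> 1.
Proof.
  pose proof PI_RGT_0 as Hpi.
  assert (Hn : 0 < INR (S n)) by (apply lt_0_INR; lia).
  set (th := 2 * PI / INR (S n)).
  assert (Hpow : forall d, (((cos th, sin th) : C) ^ d)%C = (cos (INR d * th), sin (INR d * th))).
  { induction d as [|d IH].
    - simpl. rewrite Rmult_0_l, cos_0, sin_0. reflexivity.
    - change (((cos th, sin th) : C) ^ S d)%C with (((cos th, sin th) : C) * ((cos th, sin th) : C) ^ d)%C.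
      rewrite IH, S_INR, Rmult_plus_distr_r, Rmult_1_l, (Rplus_comm _ th), cos_plus, sin_plus.
      unfold Cmult; simpl. f_equal; ring. }
  exists (cos th, sin th). repeat split.
  - unfold Cmod; simpl. rewrite !Rmult_1_r.
    pose proof (sin2_cos2 th) as H. unfold Rsqr in H.
    rewrite Rplus_comm, H. apply sqrt_1.
  - rewrite Hpow. replace (INR (S n) * th) with (2 * PI) by (unfold th; field; lra).
    rewrite cos_2PI, sin_2PI. reflexivity.
  - intros d Hd. rewrite Hpow. intros E. injection E as Ec _.
    assert (Hd1 : 0 < INR d) by (apply lt_0_INR; lia).
    assert (Hd2 : INR d < INR (S n)) by (apply lt_INR; lia).
    assert (Hq : INR d / INR (S n) < 1) by (apply Rlt_div_l; lra).
    assert (Hq0 : 0 < INR d / INR (S n)) by (apply Rdiv_lt_0_compat; lra).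
    replace (INR d * th) with (2 * (INR d / INR (S n) * PI)) in Ec by (unfold th; field; lra).
    rewrite cos_2a_sin in Ec.
    assert (0 < sin (INR d / INR (S n) * PI)) by (apply sin_gt_0; nra).
    nra.
Qed.

Lemma geometric_sum_C (q : C) n :
  ((1 - q) * sum_n (fun j => q ^ j) n = 1 - q ^ S n)%C.
Proof.
  induction n as [|n IH].
  - rewrite sum_n_0_C. simpl. ring.
  - rewrite sum_n_S_C, Cmult_plus_distr_l, IH. simpl. ring_carrier.
Qed.

(** As soon as there are more points than the degree, the mean of
    [|P|^2] over the powers of [w] is the energy of the coefficients: distinct
    exponents differ by less than the order of [w], so the cross terms sum to
    a full, hence zero, geometric progression. *)
Lemma parseval_roots (w : C) (a : nat -> C) N n :
  Cmod w = 1 -> (w ^ S N)%C = 1 ->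
  (forall d, (0 < d <= N)%nat -> (w ^ d)%C <> 1) ->
  (n <= N)%nat ->
  sum_n (fun j => Cmod (cpoly a n (w ^ j)%C) ^ 2) N = INR (S N) * energy a n.
Proof.
  intros Hw1 HwN Hwd.
  assert (Hww : (w * Cconj w)%C = 1).
  { rewrite <- Cmod2_conj, Hw1. rewrite pow1. reflexivity. }
  assert (Hpk : forall k, ((w * Cconj w) ^ k)%C = 1).
  { intros k. rewrite Hww. apply Cpow_1_l. }
  induction n as [|n IH]; intros Hn.
  - unfold energy. rewrite sum_n_0_R.
    rewrite (sum_n_ext _ (fun _ => Cmod (a 0%nat) ^ 2)); [apply sum_n_const|].
    intros j. unfold cpoly. rewrite sum_n_0_C. simpl Cpow. now rewrite Cmult_1_r.
  - rewrite energy_S, Rmult_plus_distr_l, <- IH by lia.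
    rewrite (sum_n_ext _ (fun j => (Cmod (cpoly a n (w ^ j)%C) ^ 2 + Cmod (a (S n)) ^ 2)
      + 2 * Re (cpoly a n (w ^ j) * Cconj (a (S n) * (w ^ j) ^ S n))%C)).
    2:{ intros j. unfold cpoly. rewrite sum_n_S_C, Cmod_sq_plus.
        rewrite Cmod_mult, !Cmod_pow, Hw1, !pow1, Rmult_1_r. reflexivity. }
    assert (HRe : forall (g : nat -> C) m, sum_n (fun j => 2 * Re (g j)) m = 2 * Re (sum_n g m)).
    { intros g. induction m as [|m IHm].
      - now rewrite sum_n_0_R, sum_n_0_C.
      - rewrite sum_n_S_R, sum_n_S_C, IHm, re_plus. ring_carrier. }
    assert (Hsplit : forall (x y : nat -> R) m, sum_n (fun j => x j + y j) m = sum_n x m + sum_n y m)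
      by (intros; apply (sum_n_plus x y)).
    rewrite !Hsplit, HRe, sum_n_const.
    replace (sum_n (fun j => (cpoly a n (w ^ j) * Cconj (a (S n) * (w ^ j) ^ S n))%C) N) with (RtoC 0).
    { simpl Re. ring_carrier. }
    symmetry.
    rewrite (sum_n_ext _ (fun j => sum_n (fun k => a k * Cconj (a (S n)) *
      (Cconj w ^ (S n - k)) ^ j)%C n)).
    2:{ intros j. unfold cpoly. rewrite Cmult_comm, <- sum_n_mult_l_C.
        apply sum_n_ext_loc. intros k Hk.
        rewrite Cmult_conj, !Cpow_conj, <- !Cpow_mult_r.
        replace (j * S n)%nat with (j * k + (S n - k) * j)%nat by nia.
        rewrite Cpow_add_r.
        transitivity (a k * Cconj (a (S n)) * Cconj w ^ ((S n - k) * j)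
          * (w ^ (j * k) * Cconj w ^ (j * k)))%C; [ring_carrier|].
        rewrite <- Cpow_mult_l, Hpk. ring_carrier. }
    rewrite (sum_n_switch (fun j k => a k * Cconj (a (S n)) * (Cconj w ^ (S n - k)) ^ j)%C N n).
    rewrite (sum_n_ext_loc _ (fun _ => RtoC 0)).
    { clear. induction n as [|n IH]; [apply sum_n_0_C|]. rewrite sum_n_S_C, IH. ring_carrier. }
    intros k Hk. rewrite sum_n_mult_l_C.
    set (q := (Cconj w ^ (S n - k))%C).
    assert (Hq : q <> 1).
    { unfold q. rewrite <- Cpow_conj. intros E. apply (Hwd (S n - k)%nat); [lia|].
      rewrite <- (Cconj_conj (w ^ _)%C), E. unfold Cconj; simpl. now rewrite Ropp_0. }
    assert (HqN : (q ^ S N)%C = 1).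
    { unfold q. rewrite <- Cpow_mult_r, Nat.mul_comm, Cpow_mult_r, <- Cpow_conj, HwN.
      replace (Cconj 1) with (RtoC 1) by (unfold Cconj; simpl; now rewrite Ropp_0).
      apply Cpow_1_l. }
    assert (Hg := geometric_sum_C q N). rewrite HqN in Hg.
    assert (Hz : sum_n (fun j => q ^ j)%C N = RtoC 0).
    { assert (Hne : (1 - q)%C <> 0) by (apply Cminus_eq_contra; congruence).
      transitivity (/ (1 - q) * ((1 - q) * sum_n (fun j => q ^ j) N))%C.
      - now rewrite Cmult_assoc, Cinv_l, Cmult_1_l.
      - rewrite Hg. ring_carrier. }
    change (sum_n (fun j => q ^ j)%C N) with (sum_n (Cpow q) N) in Hz. rewrite Hz. ring_carrier.
Qed.

(** * Bounded analytic functions act as contractions *)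

(** Collecting the partial sum of the product series by the power coming
    from [u] leaves shorter and shorter partial sums of [a]; when [u] and [a]
    are finitely supported and [N] is large, those are all the full
    polynomial. *)
Lemma cpoly_conv (a u : nat -> C) (z : C) N :
  cpoly (conv a u) N z = sum_n (fun j => u j * z ^ j * cpoly a (N - j) z)%C N.
Proof.
  induction N as [|N IH].
  - unfold cpoly, conv. rewrite !sum_n_0_C. simpl. ring_carrier.
  - unfold cpoly at 1. rewrite sum_n_S_C. fold (cpoly (conv a u) N z). rewrite IH.
    unfold conv. rewrite !sum_n_S_C, Nat.sub_diag.
    replace (cpoly a 0 z) with (a 0%nat) by (unfold cpoly; rewrite sum_n_0_C; simpl; ring_carrier).
    rewrite (sum_n_ext_loc (fun j => u j * z ^ j * cpoly a (S N - j) z)%C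
      (fun j => plus (u j * z ^ j * cpoly a (N - j) z)%C (z ^ S N * (u j * a (S N - j)%nat))%C)).
    2:{ intros j Hj. replace (S N - j)%nat with (S (N - j)) by lia.
        unfold cpoly at 1. rewrite sum_n_S_C. fold (cpoly a (N - j) z).
        replace (z ^ S N)%C with (z ^ j * z ^ S (N - j))%C
          by (rewrite <- Cpow_add_r; f_equal; lia).
        change (@plus C_AbelianMonoid) with Cplus. ring_carrier. }
    rewrite sum_n_plus, sum_n_mult_l_C.
    change (@plus C_AbelianMonoid) with Cplus. ring_carrier.
Qed.

Definition trunc (n : nat) (u : nat -> C) (k : nat) : C :=
  if Nat.leb k n then u k else RtoC 0.

Lemma trunc_le n u k : (k <= n)%nat -> trunc n u k = u k.
Proof. intros H. unfold trunc. apply Nat.leb_le in H. now rewrite H. Qed.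

Lemma trunc_gt n u k : (n < k)%nat -> trunc n u k = 0.
Proof. intros H. unfold trunc. apply Nat.leb_gt in H. now rewrite H. Qed.

Lemma sum_n_stable (u : nat -> C) n m :
  (n <= m)%nat -> (forall k, (n < k <= m)%nat -> u k = 0) -> sum_n u m = sum_n u n.
Proof.
  intros Hnm; induction Hnm as [|m Hnm IH]; intros H; [reflexivity|].
  rewrite sum_n_S_C, IH, (H (S m)) by (intros; try apply H; lia). ring_carrier.
Qed.

Lemma energy_stable (u : nat -> C) n m :
  (n <= m)%nat -> (forall k, (n < k <= m)%nat -> u k = RtoC 0) -> energy u m = energy u n.
Proof.
  intros Hnm; induction Hnm as [|m Hnm IH]; intros H; [reflexivity|].
  rewrite energy_S, IH, (H (S m)), Cmod_0 by (intros; try apply H; lia). ring_carrier.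
Qed.

Lemma energy_ext (u v : nat -> C) n :
  (forall k, (k <= n)%nat -> u k = v k) -> energy u n = energy v n.
Proof. intros H. apply sum_n_ext_loc. intros k Hk. now rewrite H. Qed.

Lemma conv_ext (a b u v : nat -> C) k :
  (forall j, (j <= k)%nat -> a j = b j) -> (forall j, (j <= k)%nat -> u j = v j) ->
  conv a u k = conv b v k.
Proof.
  intros Ha Hu. apply sum_n_ext_loc. intros j Hj. rewrite Hu, Ha by lia. reflexivity.
Qed.

(** The coefficients of the product up to index [n] are unchanged when both
    factors are truncated, so one may multiply polynomials and compare mean
    squares over roots of unity, where the product is at most [B] times the
    second factor. *)
Lemma poly_contraction (a u : nat -> C) (B : R) N n :
  (forall z, Cmod z = 1 -> Cmod (cpoly a N z) <= B) -> (n <= N)%nat ->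
  energy (conv a u) n <= B ^ 2 * energy u n.
Proof.
  intros HB Hn. set (L := (N + n)%nat).
  set (a' := trunc N a). set (u' := trunc n u).
  assert (Hprod : forall z, cpoly (conv a' u') L z = (cpoly u' L z * cpoly a N z)%C).
  { intros z. rewrite cpoly_conv. rewrite Cmult_comm. unfold cpoly at 3.
    rewrite <- sum_n_mult_l_C. apply sum_n_ext_loc. intros j Hj.
    destruct (Compare_dec.le_lt_dec j n) as [Hjn|Hjn].
    - replace (cpoly a' (L - j) z) with (cpoly a N z); [ring_carrier|].
      unfold cpoly. rewrite (sum_n_stable (fun k => a' k * z ^ k)%C N (L - j)).
      + apply sum_n_ext_loc. intros k Hk. unfold a'. now rewrite trunc_le.
      + unfold L; lia.
      + intros k Hk. unfold a'. rewrite trunc_gt by lia. ring_carrier.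
    - unfold u'. rewrite trunc_gt by lia. ring_carrier. }
  destruct (primitive_root L) as (w & Hw1 & HwL & Hwd).
  pose proof (parseval_roots w (conv a' u') L L Hw1 HwL Hwd (le_n L)) as P1.
  pose proof (parseval_roots w u' L L Hw1 HwL Hwd (le_n L)) as P2.
  assert (Hle : INR (S L) * energy (conv a' u') L <= B ^ 2 * (INR (S L) * energy u' L)).
  { rewrite <- P1, <- P2, <- sum_n_mult_l_R. apply sum_n_le_R. intros j _.
    rewrite Hprod, Cmod_mult, Rpow_mult_distr, Rmult_comm.
    apply Rmult_le_compat_r; [apply pow2_ge_0|].
    apply pow_incr. split; [apply Cmod_ge_0|]. apply HB.
    rewrite Cmod_pow, Hw1. apply pow1. }
  assert (HL : 0 < INR (S L)) by (apply lt_0_INR; lia).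
  assert (Hle' : energy (conv a' u') L <= B ^ 2 * energy u' L) by nra.
  replace (energy u' L) with (energy u n) in Hle'.
  - apply Rle_trans with (2 := Hle').
    apply Rle_trans with (energy (conv a' u') n); [|apply energy_mono; unfold L; lia].
    apply Req_le, energy_ext. intros k Hk. apply conv_ext; intros j Hj;
      unfold a', u'; rewrite trunc_le; trivial; lia.
  - symmetry. rewrite (energy_stable u' n L).
    + apply energy_ext. intros k Hk. apply trunc_le, Hk.
    + unfold L; lia.
    + intros k Hk. apply trunc_gt; lia.
Qed.

Lemma pow_n_Cpow (z : C) k : @pow_n C_AbsRing z k = (z ^ k)%C.
Proof. induction k as [|k IH]; [reflexivity|]. simpl. now rewrite IH. Qed.

Lemma pseries_partial_sums (a : nat -> C) (z : C) n :
  sum_n (fun k => @scal C_AbsRing C_NormedModule (@pow_n C_AbsRing z k) (a k)) n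
  = cpoly a n z.
Proof.
  apply (@sum_n_ext C_AbelianMonoid). intros k. rewrite pow_n_Cpow.
  change (z ^ k * a k = a k * z ^ k)%C. ring.
Qed.

Lemma is_pseries_cpoly (a : nat -> C) (z l : C) :
  @is_pseries C_AbsRing C_NormedModule a z l ->
  @filterlim nat C (fun n => cpoly a n z) eventually (@locally C_NormedModule l).
Proof.
  intros H. apply filterlim_ext with (2 := H). intros n. apply pseries_partial_sums.
Qed.

Lemma is_pseries_Cmod (a : nat -> C) (z l : C) :
  @is_pseries C_AbsRing C_NormedModule a z l ->
  is_lim_seq (fun n => Cmod (cpoly a n z)) (Cmod l).
Proof.
  intros H. apply is_pseries_cpoly in H.
  exact (filterlim_comp _ _ _ _ _ _ _ _ H (filterlim_norm (K := C_AbsRing) (V := C_NormedModule) l)).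
Qed.

Lemma pseries_terms_bounded (a : nat -> C) (z l : C) :
  @is_pseries C_AbsRing C_NormedModule a z l ->
  exists K, forall k, Cmod (a k) * Cmod z ^ k <= K.
Proof.
  intros H. apply is_pseries_cpoly in H.
  destruct (filterlim_bounded (K := C_AbsRing) (V := C_NormedModule) _ (ex_intro _ l H)) as [M HM].
  change (forall n, Cmod (cpoly a n z) <= M) in HM.
  exists (2 * M). intros k. rewrite <- Cmod_pow, <- Cmod_mult.
  pose proof (HM k) as H1.
  destruct k as [|k].
  - unfold cpoly in H1. rewrite sum_n_0_C in H1. pose proof (Cmod_ge_0 (a 0%nat * z ^ 0)%C). lra.
  - replace (a (S k) * z ^ S k)%C with (cpoly a (S k) z + - cpoly a k z)%C.
    + eapply Rle_trans; [apply Cmod_triangle|]. rewrite Cmod_opp. pose proof (HM k). lra.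
    + unfold cpoly. rewrite sum_n_S_C. ring_carrier.
Qed.

(** The Taylor coefficients of [z |-> f (r z)]. *)
Definition dilate (r : R) (a : nat -> C) (k : nat) : C := (a k * RtoC (r ^ k))%C.

Lemma cpoly_dilate a r n z : cpoly (dilate r a) n z = cpoly a n (RtoC r * z)%C.
Proof.
  apply sum_n_ext. intros k. unfold dilate. rewrite Cpow_mult_l, RtoC_pow. ring_carrier.
Qed.

(** Inside the disk the coefficients of the dilated function decay
    geometrically, so its Taylor polynomials converge uniformly on the unit
    circle and their maxima exceed 1 by arbitrarily little. *)
Lemma truncation_bound (f : C -> C) (a : nat -> C) (r eps : R) (n : nat) :
  disk_expansion f a -> bounded_on_disk f -> 0 < r < 1 -> 0 < eps ->
  exists N, (n <= N)%nat /\
    forall z, Cmod z = 1 -> Cmod (cpoly (dilate r a) N z) <= 1 + eps.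
Proof.
  intros Hf Hb Hr Heps.
  set (r' := (1 + r) / 2).
  assert (Hr' : r < r' < 1) by (unfold r'; lra).
  assert (Cr : forall x, 0 < x -> Cmod (RtoC x) = x).
  { intros x Hx. rewrite Cmod_R. apply Rabs_pos_eq; lra. }
  destruct (pseries_terms_bounded a (RtoC r') (f (RtoC r'))) as [K HK].
  { apply Hf. rewrite Cr; lra. }
  rewrite Cr in HK by lra.
  set (s := r / r').
  assert (Hs : 0 < s < 1).
  { unfold s. split; [apply Rdiv_lt_0_compat; lra|]. apply Rlt_div_l; lra. }
  assert (HKs : forall k, Cmod (a k) * r ^ k <= K * s ^ k).
  { intros k. replace r with (r' * s) by (unfold s; field; lra).
    rewrite Rpow_mult_distr. rewrite <- Rmult_assoc.
    apply Rmult_le_compat_r; [apply pow_le; lra|]. apply HK. }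
  assert (HK0 : 0 <= K).
  { specialize (HK 0%nat). rewrite pow_O, Rmult_1_r in HK. pose proof (Cmod_ge_0 (a 0%nat)). lra. }
  set (D := K / (1 - s)).
  assert (HD : K = D * (1 - s)) by (unfold D; field; lra).
  assert (HD0 : 0 <= D) by (unfold D; apply Rdiv_le_0_compat; lra).
  assert (Htail : forall z N L, Cmod z = 1 -> (N <= L)%nat ->
    Cmod (cpoly (dilate r a) N z) <= Cmod (cpoly (dilate r a) L z) + D * (s ^ S N - s ^ S L)).
  { intros z N L Hz HNL. induction HNL as [|L HNL IH]; [lra|].
    apply Rle_trans with (1 := IH).
    assert (Hterm : Cmod (dilate r a (S L) * z ^ S L)%C <= K * s ^ S L).
    { unfold dilate. rewrite !Cmod_mult, Cmod_pow, Hz, pow1, Rmult_1_r, Cr; [apply HKs|].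
      apply pow_lt; lra. }
    assert (Hst : Cmod (cpoly (dilate r a) L z) <= Cmod (cpoly (dilate r a) (S L) z) + K * s ^ S L).
    { replace (cpoly (dilate r a) L z) with (cpoly (dilate r a) (S L) z + - (dilate r a (S L) * z ^ S L))%C.
      - eapply Rle_trans; [apply Cmod_triangle|]. rewrite Cmod_opp. lra.
      - unfold cpoly. rewrite sum_n_S_C. ring_carrier. }
    simpl in *. rewrite HD in Hst. lra. }
  assert (HDs : is_lim_seq (fun N => D * s ^ N) 0).
  { replace (Finite 0) with (Rbar_mult D 0) by (simpl; now rewrite Rmult_0_r).
    apply is_lim_seq_scal_l, is_lim_seq_geom. rewrite Rabs_pos_eq; lra. }
  apply is_lim_seq_spec in HDs. destruct (HDs (mkposreal eps Heps)) as [N0 HN0]. simpl in HN0.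
  exists (max n N0). split; [lia|]. set (N := max n N0). intros z Hz.
  assert (HN : D * s ^ S N <= eps).
  { specialize (HN0 (S N) (Nat.le_trans _ _ _ (Nat.le_max_r n N0) (Nat.le_succ_diag_r N))). rewrite Rminus_0_r in HN0.
    eapply Rle_trans; [apply Rle_abs|]. lra. }
  enough (H : Rbar_le (Cmod (cpoly (dilate r a) N z) - D * s ^ S N) (Cmod (f (RtoC r * z)%C))).
  { change (Cmod (cpoly (dilate r a) N z) - D * s ^ S N <= Cmod (f (RtoC r * z)%C)) in H.
    assert (Hin : Cmod (RtoC r * z)%C < 1) by (rewrite Cmod_mult, Hz, Cr; lra).
    specialize (Hb _ Hin). lra. }
  apply is_lim_seq_le_loc with (u := fun _ => Cmod (cpoly (dilate r a) N z) - D * s ^ S N)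
    (v := fun L => Cmod (cpoly a L (RtoC r * z)%C)).
  - exists N. intros L HL. rewrite <- cpoly_dilate. specialize (Htail z N L Hz HL).
    assert (0 <= D * s ^ S L) by (apply Rmult_le_pos; [lra|apply pow_le; lra]). lra.
  - apply is_lim_seq_const.
  - apply is_pseries_Cmod. apply Hf. rewrite Cmod_mult, Hz, Cr; lra.
Qed.

(** Multiplication by the power series [a], truncated at any order, does
    not increase the [l^2] norm. *)
Definition contractive (a : nat -> C) : Prop :=
  forall (u : nat -> C) n, energy (conv a u) n <= energy u n.

Lemma dilate_contractive f a r :
  disk_expansion f a -> bounded_on_disk f -> 0 < r < 1 -> contractive (dilate r a).
Proof.
  intros Hf Hb Hr u n. pose proof (energy_nonneg u n) as HE.
  assert (H : forall eps, 0 < eps -> energy (conv (dilate r a) u) n <= (1 + eps) ^ 2 * energy u n).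
  { intros eps Heps. destruct (truncation_bound f a r eps n Hf Hb Hr Heps) as (N & HN & HB).
    now apply poly_contraction with (N := N). }
  apply le_epsilon. intros e He.
  set (d := e / (3 * (1 + energy u n) + e)).
  assert (Hd : 0 < d) by (apply Rdiv_lt_0_compat; lra).
  assert (Hd1 : d < 1) by (apply Rlt_div_l; lra).
  assert (Hd2 : d * (3 * (1 + energy u n)) <= e).
  { assert (d * (3 * (1 + energy u n) + e) = e) by (unfold d; field; lra). nra. }
  specialize (H d Hd). nra.
Qed.

Lemma continuous_sum_n (g : nat -> R -> R) x n :
  (forall k, continuous (g k) x) -> continuous (fun r => sum_n (fun k => g k r) n) x.
Proof.
  intros H. induction n as [|n IH].
  - apply continuous_ext with (g 0%nat); [|apply H]. intros r. now rewrite sum_n_0_R.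
  - apply continuous_ext with (fun r => plus (sum_n (fun k => g k r) n) (g (S n) r)).
    + intros r. now rewrite sum_Sn.
    + apply (continuous_plus (V := R_NormedModule)); [exact IH|apply H].
Qed.

Lemma Re_sum_n (g : nat -> C) n : Re (sum_n g n) = sum_n (fun k => Re (g k)) n.
Proof.
  induction n as [|n IH]; [now rewrite sum_n_0_C, sum_n_0_R|].
  now rewrite sum_n_S_C, sum_n_S_R, re_plus, IH.
Qed.

Lemma Im_sum_n (g : nat -> C) n : Im (sum_n g n) = sum_n (fun k => Im (g k)) n.
Proof.
  induction n as [|n IH]; [now rewrite sum_n_0_C, sum_n_0_R|].
  now rewrite sum_n_S_C, sum_n_S_R, <- IH.
Qed.

Lemma continuous_pow_R (x : R) k : continuous (fun r : R => r ^ k) x.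
Proof.
  apply continuity_pt_filterlim, derivable_continuous_pt, derivable_pt_pow.
Qed.

Lemma continuous_sq (g : R -> R) x : continuous g x -> continuous (fun r => g r ^ 2) x.
Proof.
  intros H. apply (continuous_comp g (fun y => y ^ 2)); [exact H|apply continuous_pow_R].
Qed.

(** For fixed [n] this is a polynomial in [r]; it serves to let the
    dilation parameter tend to 1. *)
Lemma continuous_conv_dilate (a u : nat -> C) n x :
  continuous (fun r => energy (conv (dilate r a) u) n) x.
Proof.
  apply (continuous_sum_n (fun k r => Cmod (conv (dilate r a) u k) ^ 2)). intros k.
  apply continuous_ext with (fun r => plus
    (sum_n (fun j => Re (u j * a (k - j)%nat)%C * r ^ (k - j)) k ^ 2)
    (sum_n (fun j => Im (u j * a (k - j)%nat)%C * r ^ (k - j)) k ^ 2)).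
  - intros r. rewrite Cmod2_alt. unfold conv. rewrite Re_sum_n, Im_sum_n.
    change (@plus R_AbelianMonoid) with Rplus.
    f_equal; f_equal; apply sum_n_ext; intros j; unfold dilate; rewrite Cmult_assoc;
      [now rewrite re_scal_r|now rewrite im_scal_r].
  - assert (Hc : forall c i, continuous (fun r : R => c * r ^ i) x).
    { intros c i. apply (continuous_mult (K := R_AbsRing) (fun _ => c) (fun r => r ^ i));
        [apply continuous_const|apply continuous_pow_R]. }
    apply (continuous_plus (V := R_NormedModule)); apply (continuous_sq (fun r => sum_n _ k)).
    + refine (continuous_sum_n (fun j r => Re (u j * a (k - j)%nat)%C * r ^ (k - j)) x k _).
      intros j. apply Hc.
    + refine (continuous_sum_n (fun j r => Im (u j * a (k - j)%nat)%C * r ^ (k - j)) x k _).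
      intros j. apply Hc.
Qed.

(** Each dilation is contractive, and a truncated energy is continuous in the
    dilation parameter, so the estimate survives the passage to radius 1. *)
Lemma disk_contraction f a :
  disk_expansion f a -> bounded_on_disk f -> contractive a.
Proof.
  intros Hf Hb u n.
  assert (H1 : energy (conv (dilate 1 a) u) n = energy (conv a u) n).
  { apply energy_ext. intros k _. apply conv_ext; trivial. intros j _.
    unfold dilate. rewrite pow1. ring. }
  rewrite <- H1.
  assert (Hle : Rbar_le (energy (conv (dilate 1 a) u) n) (energy u n)); [|exact Hle].
  apply (filterlim_le (F := at_left 1) (fun r => energy (conv (dilate r a) u) n) (fun _ => energy u n)).
  - exists (mkposreal (1/2) ltac:(lra)). intros r Hr Hr1.
    apply (dilate_contractive f); trivial.
    change (Rabs (r - 1) < 1/2) in Hr. apply Rabs_def2 in Hr. lra.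
  - apply (filterlim_filter_le_1 (F := locally 1)).
    + apply filter_le_within.
    + apply (continuous_conv_dilate a u n 1).
  - apply filterlim_const.
Qed.

(** * Coefficient inequalities *)

Lemma le_of_sq_le (x y : R) : 0 <= y -> x ^ 2 <= y ^ 2 -> x <= y.
Proof. intros Hy H. apply Rsqr_incr_0_var; [unfold Rsqr; lra|trivial]. Qed.

(** [M = 1/(1-E)] is optimal; when [E = 1] the left side grows
    linearly in [M] with slope [2 Q], which forces [Q = 0]. *)
Lemma optimal_multiplier (Q K E : R) :
  0 <= Q -> 0 <= E <= 1 ->
  (forall M, Q * (1 + M * E) ^ 2 <= K + M ^ 2 * Q * E) -> Q <= (1 - E) * K.
Proof.
  intros HQ HE H. destruct (Req_dec E 1) as [->|Hne].
  - assert (HQ0 : Q = 0); [|lra].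
    destruct (Req_dec Q 0) as [|HQ0]; [trivial|exfalso].
    pose proof (H 0) as H0. specialize (H (K / Q)).
    assert (HK : Q * (K / Q) = K) by (field; trivial).
    set (x := K / Q) in *. replace (Q * (1 + x * 1) ^ 2) with (Q + 2 * (Q * x) + x ^ 2 * Q * 1) in H by ring.
    rewrite HK in H. lra.
  - specialize (H (/ (1 - E))).
    replace (1 + / (1 - E) * E) with (/ (1 - E)) in H by (field; lra).
    assert (H1 : Q / (1 - E) <= K).
    { replace (Q / (1 - E)) with (Q * (/ (1 - E)) ^ 2 - (/ (1 - E)) ^ 2 * Q * E) by (field; lra). lra. }
    apply Rle_div_l in H1; lra.
Qed.

(** The polynomial [1 + al z^p]. *)
Definition two_point (al : C) (p k : nat) : C :=
  if Nat.eqb k 0 then RtoC 1 else if Nat.eqb k p then al else RtoC 0.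

Lemma sum_two_point (al : C) p (g : nat -> C) n :
  sum_n (fun j => two_point al (S p) j * g j)%C n
  = (g 0%nat + if Nat.leb (S p) n then al * g (S p) else 0)%C.
Proof.
  induction n as [|n IH].
  - rewrite sum_n_0_C. unfold two_point. simpl. ring_carrier.
  - rewrite sum_n_S_C, IH. unfold two_point. simpl Nat.eqb at 1. cbv iota.
    destruct (Nat.eqb_spec (S n) (S p)) as [Heq|Hne].
    + injection Heq as ->.
      rewrite (proj2 (Nat.leb_gt (S p) p)), (proj2 (Nat.leb_le (S p) (S p))) by lia. ring_carrier.
    + replace (Nat.leb (S p) (S n)) with (Nat.leb (S p) n); [ring_carrier|].
      apply Bool.eq_iff_eq_true. rewrite !Nat.leb_le. lia.
Qed.

Lemma conv_two_point (a : nat -> C) al p k :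
  conv a (two_point al (S p)) k
  = (a k + if Nat.leb (S p) k then al * a (k - S p)%nat else 0)%C.
Proof.
  unfold conv. rewrite (sum_two_point al p (fun j => a (k - j)%nat)).
  now rewrite Nat.sub_0_r.
Qed.

Lemma conv_one (a : nat -> C) p k : conv a (two_point 0 (S p)) k = a k.
Proof. rewrite conv_two_point. destruct (Nat.leb (S p) k); ring_carrier. Qed.

Lemma energy_two_point al p n :
  energy (two_point al (S p)) n = 1 + (if Nat.leb (S p) n then Cmod al ^ 2 else 0).
Proof.
  induction n as [|n IH].
  - unfold energy. rewrite sum_n_0_R. unfold two_point. simpl Nat.eqb. cbv iota.
    rewrite Cmod_1. simpl. ring_carrier.
  - rewrite energy_S, IH. unfold two_point. simpl Nat.eqb at 1. cbv iota.
    destruct (Nat.eqb_spec (S n) (S p)) as [Heq|Hne].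
    + injection Heq as ->.
      rewrite (proj2 (Nat.leb_gt (S p) p)), (proj2 (Nat.leb_le (S p) (S p))) by lia. ring_carrier.
    + rewrite Cmod_0. replace (Nat.leb (S p) (S n)) with (Nat.leb (S p) n); [ring_carrier|].
      apply Bool.eq_iff_eq_true. rewrite !Nat.leb_le. lia.
Qed.

Lemma energy_one p n : energy (two_point 0 (S p)) n = 1.
Proof. rewrite energy_two_point, Cmod_0. destruct (Nat.leb (S p) n); ring_carrier. Qed.

Lemma energy_le_1 a n : contractive a -> energy a n <= 1.
Proof.
  intros Ha. specialize (Ha (two_point 0 1) n). rewrite energy_one in Ha.
  rewrite (energy_ext _ a) in Ha; trivial. intros k _. apply conv_one.
Qed.

(** A form of Parrott's lemma: the corner entry of a contraction is
    controlled by what the neighbouring blocks leave of the norm.  Extend [v]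
    beyond [l] by a multiple [s] of the conjugated coefficients that multiply
    it in the [m]-th entry of the product: this adds [|s|^2 E] to the energy
    of the argument and [s E] to that entry, and [s] is then optimized. *)
Lemma gap_inequality (a v : nat -> C) l m :
  contractive a -> (S l <= m)%nat ->
  Cmod (conv a (trunc l v) m) ^ 2
  <= (1 - energy a (m - S l)) * (energy v l - energy (conv a v) l).
Proof.
  intros Ha Hlm. set (d := (m - S l)%nat). assert (Hm : m = (l + S d)%nat) by (unfold d; lia).
  set (E := energy a d). set (q := conv a (trunc l v) m).
  apply optimal_multiplier; [apply pow2_ge_0| |].
  { split; [apply energy_nonneg|now apply energy_le_1]. }
  intros M.
  (* The best [s] is a real multiple of the entry [q] itself. *)
  set (s := (RtoC M * q)%C).
  set (u := fun k => if Nat.leb k l then v k else (s * Cconj (a (m - k)%nat))%C).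
  assert (Hul : forall k, (k <= l)%nat -> u k = v k).
  { intros k Hk. unfold u. apply Nat.leb_le in Hk. now rewrite Hk. }
  assert (Hur : forall i, (i <= d)%nat -> u (S l + i)%nat = (s * Cconj (a (d - i)%nat))%C).
  { intros i Hi. unfold u. rewrite (proj2 (Nat.leb_gt (S l + i) l)) by lia.
    do 3 f_equal. lia. }
  assert (HEu : energy u m = energy v l + Cmod s ^ 2 * E).
  { unfold energy at 1. rewrite Hm, sum_n_split. fold (energy u l).
    change (@plus R_AbelianMonoid) with Rplus. f_equal; [now apply energy_ext|].
    unfold E, energy. rewrite <- (sum_n_rev (fun k => Cmod (a k) ^ 2)), <- sum_n_mult_l_R.
    apply sum_n_ext_loc. intros i Hi. rewrite Hur by trivial.
    rewrite Cmod_mult, Cmod_conj. ring_carrier. }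
  assert (Hcm : conv a u m = (q + s * RtoC E)%C).
  { unfold q, conv. rewrite Hm, !sum_n_split.
    change (@plus C_AbelianMonoid) with Cplus.
    rewrite (sum_n_ext_loc (fun j => u j * a (l + S d - j)%nat)%C
      (fun j => trunc l v j * a (l + S d - j)%nat)%C l).
    2:{ intros j Hj. now rewrite Hul, trunc_le. }
    rewrite (sum_n_ext_loc (fun i => trunc l v (S l + i)%nat * _)%C (fun _ => RtoC 0 * RtoC 0)%C d).
    2:{ intros i Hi. rewrite trunc_gt by lia. ring_carrier. }
    rewrite sum_n_mult_l_C.
    assert (HE : sum_n (fun i => u (S l + i)%nat * a (l + S d - (S l + i))%nat)%C d = (s * RtoC E)%C).
    { rewrite (sum_n_ext_loc _ (fun i => s * (fun k => RtoC (Cmod (a k) ^ 2)) (d - i)%nat)%C).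
      2:{ intros i Hi. rewrite Hur by trivial. rewrite RtoC_pow, <- RtoC_pow, Cmod2_conj.
          replace (l + S d - (S l + i))%nat with (d - i)%nat by lia. ring_carrier. }
      rewrite sum_n_mult_l_C, (sum_n_rev (fun k => RtoC (Cmod (a k) ^ 2)) d). f_equal.
      unfold E, energy. clear. induction d as [|d IH].
      - now rewrite sum_n_0_C, sum_n_0_R.
      - now rewrite sum_n_S_C, sum_n_S_R, IH, RtoC_plus. }
    rewrite HE. ring_carrier. }
  pose proof (Ha u m) as H. rewrite HEu in H.
  assert (Hlow : energy (conv a v) l + Cmod (conv a u m) ^ 2 <= energy (conv a u) m).
  { rewrite Hm, Nat.add_succ_r, energy_S.
    apply Rplus_le_compat_r. apply Rle_trans with (energy (conv a u) l).
    - apply Req_le, energy_ext. intros k Hk. apply conv_ext; trivial.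
      intros j Hj. symmetry. apply Hul. lia.
    - apply energy_mono. lia. }
  rewrite Hcm in Hlow. unfold s in *.
  replace (q + RtoC M * q * RtoC E)%C with (q * RtoC (1 + M * E))%C in Hlow
    by (rewrite RtoC_plus, RtoC_mult; ring).
  rewrite !Cmod_mult, !Cmod_R, !Rpow_mult_distr, !pow2_abs in *. lra.
Qed.

Lemma trunc_two_point al p l : (S p <= l)%nat -> forall j, trunc l (two_point al (S p)) j = two_point al (S p) j.
Proof.
  intros Hp j. destruct (Compare_dec.le_lt_dec j l) as [Hjn|Hjn].
  - now apply trunc_le.
  - rewrite trunc_gt by lia. unfold two_point. destruct j; [lia|].
    simpl Nat.eqb at 1. cbv iota. destruct (Nat.eqb_spec (S j) (S p)); [lia|trivial].
Qed.

Lemma trunc_one p l j : trunc l (two_point 0 (S p)) j = two_point 0 (S p) j.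
Proof.
  destruct (Compare_dec.le_lt_dec j l) as [Hjn|Hjn].
  - now apply trunc_le.
  - rewrite trunc_gt by lia. unfold two_point. destruct j; [lia|].
    simpl Nat.eqb at 1. cbv iota. now destruct (Nat.eqb _ _).
Qed.

(** The gap inequality for [v = 1] and [m = n + 1]: a Schwarz-Pick
    estimate that also accounts for all intermediate coefficients. *)
Lemma coef_sq_bound a n :
  contractive a ->
  Cmod (a (S n)) ^ 2 <= (1 - Cmod (a 0%nat) ^ 2) * (1 - energy a n).
Proof.
  intros Ha. pose proof (gap_inequality a (two_point 0 (S (S n))) n (S n) Ha (le_n _)) as H.
  rewrite Nat.sub_diag, energy_one in H.
  rewrite (energy_ext (conv a _) a) in H by (intros; apply conv_one).
  rewrite (conv_ext a a _ (two_point 0 (S (S n)))), conv_one in H; trivial.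
  - unfold energy at 1 in H. now rewrite sum_n_0_R in H.
  - intros; apply trunc_one.
Qed.

(** The gap inequality for [v = 1] and [m = 2 n + 1], where both factors on
    its right-hand side equal [1 - energy a n]. *)
Lemma odd_coef_bound a n :
  contractive a -> Cmod (a (2 * n + 1)%nat) <= 1 - energy a n.
Proof.
  intros Ha. pose proof (energy_le_1 a n Ha) as H1.
  assert (Hnm : (S n <= 2 * n + 1)%nat) by lia.
  pose proof (gap_inequality a (two_point 0 1) n (2 * n + 1) Ha Hnm) as H.
  replace (2 * n + 1 - S n)%nat with n in H by lia.
  rewrite energy_one in H.
  rewrite (energy_ext (conv a _) a) in H by (intros; apply conv_one).
  rewrite (conv_ext a a _ (two_point 0 1)), conv_one in H; trivial.
  - apply le_of_sq_le; lra.
  - intros; apply trunc_one.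
Qed.

Lemma align (x y : C) : exists xi : C, Cmod xi = 1 /\ Cmod (x + xi * y)%C = Cmod x + Cmod y.
Proof.
  destruct (Req_dec (Cmod x) 0) as [Hx|Hx].
  { exists (RtoC 1). rewrite (Cmod_eq_0 _ Hx), Cmod_0, Cmod_1. split; trivial.
    replace (0 + 1 * y)%C with y by ring. ring. }
  destruct (Req_dec (Cmod y) 0) as [Hy|Hy].
  { exists (RtoC 1). rewrite (Cmod_eq_0 _ Hy), Cmod_0, Cmod_1. split; trivial.
    replace (x + 1 * 0)%C with x by ring. ring. }
  pose proof (Cmod_ge_0 x). pose proof (Cmod_ge_0 y).
  assert (Hx0 : x <> 0) by (intros ->; now rewrite Cmod_0 in Hx).
  assert (Hy0 : y <> 0) by (intros ->; now rewrite Cmod_0 in Hy).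
  exists (x * RtoC (Cmod y / Cmod x) / y)%C. split.
  - rewrite Cmod_div, Cmod_mult, Cmod_R, Rabs_pos_eq by (trivial || (apply Rdiv_le_0_compat; lra)).
    field. split; trivial.
  - replace (x + x * RtoC (Cmod y / Cmod x) / y * y)%C with (x * RtoC (1 + Cmod y / Cmod x))%C.
    + assert (0 <= Cmod y / Cmod x) by (apply Rdiv_le_0_compat; lra).
      rewrite Cmod_mult, Cmod_R, Rabs_pos_eq by lra. field. trivial.
    + rewrite RtoC_plus. field. trivial.
Qed.

(** The gap inequality for [v = 1 + al z^(n+1)].  With [b = |a_(n+1)|] and
    [p = |a_0|], the modulus [b/(1+p)] of [al] solves [b - |al| p = |al|], so
    that the energy gained in the argument is lost again in the coefficient of
    index [n + 1]; the phase of [al] aligns [al a_(n+1)] with [a_(2n+2)]. *)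
Lemma even_coef_bound a n :
  contractive a ->
  Cmod (a (2 * S n)%nat) <= 1 - energy a n - Cmod (a (S n)) ^ 2 / (1 + Cmod (a 0%nat)).
Proof.
  intros Ha. pose proof (energy_le_1 a n Ha) as H1.
  set (p := Cmod (a 0%nat)). set (b := Cmod (a (S n))).
  assert (Hp : 0 <= p) by apply Cmod_ge_0. assert (Hb : 0 <= b) by apply Cmod_ge_0.
  set (t := b / (1 + p)).
  assert (Ht : 0 <= t) by (apply Rdiv_le_0_compat; lra).
  assert (Hbt : b = t * (1 + p)) by (unfold t; field; lra).
  destruct (align (a (2 * S n)%nat) (RtoC t * a (S n))%C) as (xi & Hxi & Hsum).
  set (al := (xi * RtoC t)%C).
  assert (Hal : Cmod al = t).
  { unfold al. rewrite Cmod_mult, Hxi, Cmod_R, Rabs_pos_eq; lra. }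
  assert (Hnm : (S (S n) <= 2 * S n)%nat) by lia.
  pose proof (gap_inequality a (two_point al (S n)) (S n) (2 * S n) Ha Hnm) as H.
  replace (2 * S n - S (S n))%nat with n in H by lia.
  rewrite (conv_ext a a _ (two_point al (S n))), conv_two_point, energy_two_point, energy_S in H.
  2: trivial.
  2: intros; now apply trunc_two_point.
  rewrite conv_two_point, !(proj2 (Nat.leb_le _ _)), Nat.sub_diag, Hal in H by lia.
  replace (2 * S n - S n)%nat with (S n) in H by lia.
  rewrite (energy_ext (conv a _) a) in H.
  2:{ intros k Hk. rewrite conv_two_point, (proj2 (Nat.leb_gt (S n) k)) by lia. ring. }
  unfold al at 1 in H. rewrite <- Cmult_assoc, Hsum, Cmod_mult, Cmod_R, Rabs_pos_eq in H by lra.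
  fold b in H.
  assert (Hlow : t <= Cmod (a (S n) + al * a 0%nat)%C).
  { assert (Htri : b <= Cmod (a (S n) + al * a 0%nat)%C + Cmod (al * a 0%nat)%C).
    { unfold b. rewrite <- (Cmod_opp (al * a 0%nat)%C).
      eapply Rle_trans; [|apply Cmod_triangle]. right. f_equal. ring. }
    rewrite Cmod_mult, Hal in Htri. fold p in Htri. lra. }
  assert (Hsq : t ^ 2 <= Cmod (a (S n) + al * a 0%nat)%C ^ 2) by (apply pow_incr; lra).
  assert (Hfin : Cmod (a (2 * S n)%nat) + t * b <= 1 - energy a n).
  { apply le_of_sq_le; [lra|]. apply Rle_trans with (1 := H).
    simpl (_ ^ 2). rewrite Rmult_1_r. apply Rmult_le_compat_l; lra. }
  replace (b ^ 2 / (1 + p)) with (t * b) by (unfold t; field; lra). lra.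
Qed.

(** * The majorant and area bounds *)

Lemma series_bounded (u : nat -> R) B :
  (forall n, 0 <= u n) -> (forall n, sum_n u n <= B) -> ex_series u /\ Series u <= B.
Proof.
  intros Hu HB.
  assert (Hex : ex_series u).
  { destruct (ex_finite_lim_seq_incr (sum_n u) B) as [l Hl]; trivial.
    - intros n. rewrite sum_n_S_R. specialize (Hu (S n)). lra.
    - exists l. exact Hl. }
  split; trivial.
  apply Series_correct in Hex.
  exact (is_lim_seq_le (sum_n u) (fun _ => B) (Series u) B HB Hex (is_lim_seq_const B)).
Qed.

Lemma sum_n_le_Series (u : nat -> R) n :
  (forall k, 0 <= u k) -> ex_series u -> sum_n u n <= Series u.
Proof.
  intros Hu Hex. apply Series_correct in Hex.
  apply (is_lim_seq_incr_compare (sum_n u)); trivial.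
  intros k. rewrite sum_n_S_R. specialize (Hu (S k)). lra.
Qed.

Lemma sum_n_shift (u : nat -> R) n : sum_n (fun k => u (S k)) n = sum_n u (S n) - u 0%nat.
Proof.
  induction n as [|n IH].
  - rewrite sum_n_S_R, !sum_n_0_R. ring_carrier.
  - rewrite sum_n_S_R, IH, !(sum_n_S_R u). ring_carrier.
Qed.

Lemma sum_n_mono_R (u : nat -> R) n m :
  (forall k, 0 <= u k) -> (n <= m)%nat -> sum_n u n <= sum_n u m.
Proof.
  intros Hu H. induction H as [|m _ IH]; [apply Rle_refl|].
  rewrite sum_n_S_R. specialize (Hu (S m)). lra.
Qed.

(** Induction on [N], adding the coefficients of index [2N+2] and [2N+3]
    through Carlson's inequalities.  The index ranges start at 0, and the
    terms [p] and [p^2] remove the contribution of [a_0]. *)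
Lemma majorant_partial_sum (a : nat -> C) r N :
  contractive a -> 0 <= r < 1 ->
  let p := Cmod (a 0%nat) in
  sum_n (fun k => Cmod (a k) * r ^ k) (2 * N + 1) - p
  + (1 / (1 + p) + r / (1 - r)) * (sum_n (fun k => Cmod (a k) ^ 2 * r ^ (2 * k)) N - p ^ 2)
  <= ((1 - p ^ 2) * r - (1 - energy a N) * r ^ (2 * N + 2)) / (1 - r).
Proof.
  intros Ha Hr p. assert (Hp : 0 <= p) by apply Cmod_ge_0.
  induction N as [|N IH].
  - pose proof (odd_coef_bound a 0 Ha) as H. unfold energy in *. rewrite sum_n_0_R in *.
    simpl (2 * 0 + 1)%nat in *. rewrite sum_n_S_R, !sum_n_0_R. simpl (2 * 0)%nat. simpl (0 + 2)%nat.
    fold p in H |- *. rewrite !pow_O.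
    replace (((1 - p ^ 2) * r - (1 - p ^ 2) * r ^ 2) / (1 - r)) with ((1 - p ^ 2) * r) by (field; lra).
    rewrite pow_1. nra.
  - replace (2 * S N + 1)%nat with (S (S (2 * N + 1))) by lia.
    replace (2 * S N + 2)%nat with (S (S (2 * N + 2))) by lia.
    rewrite !sum_n_S_R, energy_S.
    pose proof (even_coef_bound a N Ha) as He. fold p in He.
    pose proof (odd_coef_bound a (S N) Ha) as Ho. rewrite energy_S in Ho.
    replace (2 * S N)%nat with (S (2 * N + 1)) in * by lia.
    replace (S (2 * N + 1) + 1)%nat with (S (S (2 * N + 1))) in Ho by lia.
    replace (2 * N + 2)%nat with (S (2 * N + 1)) in * by lia.
    set (x := Cmod (a (S (2 * N + 1)))) in *. set (y := Cmod (a (S (S (2 * N + 1))))) in *.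
    set (b := Cmod (a (S N)) ^ 2) in *. set (E := energy a N) in *.
    change (r ^ S (S (S (2 * N + 1)))) with (r * (r * r ^ S (2 * N + 1))).
    change (r ^ S (S (2 * N + 1))) with (r * r ^ S (2 * N + 1)).
    set (q := r ^ S (2 * N + 1)) in *.
    assert (Hq : 0 <= q) by (apply pow_le; lra).
    assert (H1 : x * q <= (1 - E - b / (1 + p)) * q) by (apply Rmult_le_compat_r; trivial).
    assert (H2 : y * (r * q) <= (1 - (E + b)) * (r * q)) by (apply Rmult_le_compat_r; trivial; nra).
    set (s1 := sum_n _ _) in *. set (s2 := sum_n _ _) in *.
    assert (Hid : ((1 - p ^ 2) * r - (1 - (E + b)) * (r * (r * q))) / (1 - r)
      = ((1 - p ^ 2) * r - (1 - E) * q) / (1 - r)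
        + (1 / (1 + p) + r / (1 - r)) * (b * q) + (1 - E - b / (1 + p)) * q + (1 - (E + b)) * (r * q)).
    { field. split; lra. }
    rewrite Hid. lra.
Qed.

(** The negative term left over in [majorant_partial_sum] can be dropped,
    which bounds all partial sums and gives convergence at the same time. *)
Lemma majorant_bound (a : nat -> C) r :
  contractive a -> 0 <= r < 1 ->
  let p := Cmod (a 0%nat) in
  majorant0 a r + (1 / (1 + p) + r / (1 - r)) * norm0_sq a r <= (1 - p ^ 2) * (r / (1 - r)).
Proof.
  intros Ha Hr p. set (k0 := 1 / (1 + p) + r / (1 - r)).
  assert (Hp : 0 <= p) by apply Cmod_ge_0.
  assert (Hk0 : 0 < k0).
  { apply Rplus_lt_le_0_compat; [apply Rdiv_lt_0_compat; lra|apply Rdiv_le_0_compat; lra]. }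
  set (B := (1 - p ^ 2) * (r / (1 - r))).
  set (F := fun k => Cmod (a k) * r ^ k). set (G := fun k => Cmod (a k) ^ 2 * r ^ (2 * k)).
  assert (HF : forall k, 0 <= F k).
  { intros k. apply Rmult_le_pos; [apply Cmod_ge_0|apply pow_le; lra]. }
  assert (HG : forall k, 0 <= G k).
  { intros k. apply Rmult_le_pos; [apply pow2_ge_0|apply pow_le; lra]. }
  assert (Hboth : forall n, sum_n (fun k => F (S k)) n + k0 * sum_n (fun k => G (S k)) n <= B).
  { intros n. rewrite !sum_n_shift.
    pose proof (majorant_partial_sum a r (S n) Ha Hr) as H. cbv zeta in H. fold p in H. fold k0 F G in H.
    assert (HFm : sum_n F (S n) <= sum_n F (2 * S n + 1)) by (apply sum_n_mono_R; trivial; lia).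
    assert (Htail : ((1 - p ^ 2) * r - (1 - energy a (S n)) * r ^ (2 * S n + 2)) / (1 - r) <= B).
    { unfold B, Rdiv. rewrite <- Rmult_assoc. apply Rmult_le_compat_r.
      - left. apply Rinv_0_lt_compat; lra.
      - pose proof (energy_le_1 a (S n) Ha). assert (0 <= r ^ (2 * S n + 2)) by (apply pow_le; lra). nra. }
    replace (F 0%nat) with p by (unfold F, p; simpl; ring).
    replace (G 0%nat) with (p ^ 2) by (unfold G, p; simpl; ring). lra. }
  assert (HF0 : forall n, 0 <= sum_n (fun k => F (S k)) n).
  { intros n. apply Rle_trans with (F 1%nat); [apply HF|]. rewrite <- (sum_n_0_R (fun k => F (S k))).
    apply sum_n_mono_R; [intros; apply HF|lia]. }
  assert (HG0 : forall n, 0 <= sum_n (fun k => G (S k)) n).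
  { intros n. apply Rle_trans with (G 1%nat); [apply HG|]. rewrite <- (sum_n_0_R (fun k => G (S k))).
    apply sum_n_mono_R; [intros; apply HG|lia]. }
  destruct (series_bounded (fun k => F (S k)) B) as [HexF _]; [intros; apply HF| |].
  { intros n. specialize (Hboth n). specialize (HG0 n). nra. }
  destruct (series_bounded (fun k => G (S k)) (B / k0)) as [HexG _]; [intros; apply HG| |].
  { intros n. specialize (Hboth n). specialize (HF0 n). apply Rle_div_r; [trivial|]. lra. }
  change (Series (fun k => F (S k)) + k0 * Series (fun k => G (S k)) <= B).
  rewrite <- Series_scal_l, <- Series_plus; trivial.
  2: exact (ex_series_scal_l (K := R_AbsRing) k0 (fun k => G (S k)) HexG).
  apply series_bounded.
  - intros n. specialize (HF (S n)). specialize (HG (S n)). nra.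
  - intros n. apply Rle_trans with (2 := Hboth n). right.
    rewrite <- sum_n_mult_l_R.
    apply (sum_n_plus (fun k => F (S k)) (fun k => k0 * G (S k))).
Qed.

(** The quantity [1 - energy a n] decreases at most by the factor
    [|a_0|^2] at each step, as it does exactly for a disk automorphism. *)
Lemma energy_gap a n :
  contractive a ->
  (1 - Cmod (a 0%nat) ^ 2) * (Cmod (a 0%nat) ^ 2) ^ n <= 1 - energy a n.
Proof.
  intros Ha. set (P := Cmod (a 0%nat) ^ 2). assert (HP : 0 <= P) by apply pow2_ge_0.
  induction n as [|n IH].
  - unfold energy. rewrite sum_n_0_R. fold P. simpl. lra.
  - rewrite energy_S. pose proof (coef_sq_bound a n Ha) as H. fold P in H. simpl pow. nra.
Qed.

(** Abel summation: nonincreasing weights preserve nonnegativity of partial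
    sums.  The term on the left is what makes the induction work. *)
Lemma abel_nonneg (w d : nat -> R) n :
  (forall k, 0 <= w k) -> (forall k, w (S k) <= w k) -> (forall k, 0 <= sum_n d k) ->
  w n * sum_n d n <= sum_n (fun k => w k * d k) n.
Proof.
  intros Hw Hdec Hd. induction n as [|n IH].
  - rewrite !sum_n_0_R. apply Rle_refl.
  - rewrite !sum_n_S_R. specialize (Hdec n). specialize (Hd n). nra.
Qed.

(** The Cauchy square of the geometric series. *)
Lemma is_series_arith_geom x :
  0 <= x < 1 -> is_series (fun k => INR (S k) * x ^ k) (1 / (1 - x) ^ 2).
Proof.
  intros Hx.
  assert (Hg : is_series (fun k => x ^ k) (/ (1 - x))) by (apply is_series_geom; rewrite Rabs_pos_eq; lra).
  assert (Hpos : forall n, 0 <= x ^ n) by (intros; apply pow_le; lra).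
  pose proof (is_series_mult_pos _ _ _ _ Hg Hg Hpos Hpos) as H.
  replace (1 / (1 - x) ^ 2) with (/ (1 - x) * / (1 - x)) by (field; lra).
  apply is_series_ext with (2 := H). intros n.
  rewrite <- sum_n_Reals, (sum_n_ext_loc _ (fun _ => x ^ n)); [apply sum_n_const|].
  intros k Hk. rewrite <- pow_add. f_equal. lia.
Qed.

(** The partial sums of [|a_n|^2] are dominated by those of the disk
    automorphism with the same [|a_0|]; the weights [n r^(2n)] are
    nonincreasing since [(n+1) r^2 <= n] for [n >= 1] and [r^2 <= 1/2], so
    Abel summation carries the domination over to the areas. *)
Lemma area_bound (a : nat -> C) r :
  contractive a -> 0 <= r <= 1 / 2 ->
  let P := Cmod (a 0%nat) ^ 2 in
  0 <= image_area a r / PI <= (1 - P) ^ 2 * r ^ 2 / (1 - P * r ^ 2) ^ 2.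
Proof.
  intros Ha Hr P. assert (HP : 0 <= P) by apply pow2_ge_0.
  assert (HP1 : P <= 1).
  { pose proof (energy_le_1 a 0 Ha) as H. unfold energy in H. now rewrite sum_n_0_R in H. }
  assert (Hr2 : 0 <= r ^ 2 <= 1 / 4) by nra.
  set (x := P * r ^ 2). assert (Hx : 0 <= x < 1) by (unfold x; nra).
  set (w := fun k => INR (S k) * (r ^ 2) ^ S k).
  set (u := fun k => INR (S k) * Cmod (a (S k)) ^ 2 * r ^ (2 * S k)).
  replace (image_area a r / PI) with (Series u)
    by (unfold image_area; fold u; field; apply PI_neq0).
  set (v := fun k => (1 - P) ^ 2 * r ^ 2 * (INR (S k) * x ^ k)).
  assert (Hv : is_series v ((1 - P) ^ 2 * r ^ 2 / (1 - x) ^ 2)).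
  { replace ((1 - P) ^ 2 * r ^ 2 / (1 - x) ^ 2) with ((1 - P) ^ 2 * r ^ 2 * (1 / (1 - x) ^ 2)) by (field; lra).
    exact (is_series_scal_l (K := R_AbsRing) ((1 - P) ^ 2 * r ^ 2) _ _ (is_series_arith_geom x Hx)). }
  assert (HINR : forall k, 1 <= INR (S k)).
  { intros k. rewrite S_INR. pose proof (pos_INR k). lra. }
  assert (Hv0 : forall k, 0 <= v k).
  { intros k. pose proof (HINR k). assert (0 <= x ^ k) by (apply pow_le; lra).
    unfold v. apply Rmult_le_pos; [apply Rmult_le_pos; [apply pow2_ge_0|lra]|nra]. }
  assert (Hu0 : forall k, 0 <= u k).
  { intros k. pose proof (HINR k). unfold u. apply Rmult_le_pos; [|apply pow_le; lra].
    apply Rmult_le_pos; [lra|apply pow2_ge_0]. }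
  assert (Hw0 : forall k, 0 <= w k).
  { intros k. pose proof (HINR k). unfold w. apply Rmult_le_pos; [lra|apply pow_le; lra]. }
  assert (Huv : forall n, sum_n u n <= sum_n v n).
  { intros n.
    (* The excess of the extremal squared coefficients over the given ones. *)
    set (d := fun k => (1 - P) ^ 2 * P ^ k - Cmod (a (S k)) ^ 2).
    assert (Hd : forall m, sum_n d m = (1 - P) * (1 - P ^ S m) - (energy a (S m) - P)).
    { intros m. induction m as [|m IH].
      - rewrite sum_n_0_R, energy_S. unfold energy. rewrite sum_n_0_R. fold P. unfold d. simpl. ring.
      - rewrite sum_n_S_R, IH, (energy_S a (S m)). unfold d. simpl. ring. }
    assert (Hd0 : forall m, 0 <= sum_n d m).
    { intros m. rewrite Hd. pose proof (energy_gap a (S m) Ha) as H. fold P in H. lra. }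
    assert (Hdec : forall k, w (S k) <= w k).
    { intros k. unfold w. simpl ((r ^ 2) ^ S (S k)). rewrite <- Rmult_assoc.
      change (r ^ 2 * (r ^ 2) ^ k) with ((r ^ 2) ^ S k).
      assert (0 <= (r ^ 2) ^ S k) by (apply pow_le; lra).
      rewrite (S_INR (S k)). pose proof (HINR k).
      apply Rmult_le_compat_r; [trivial|]. nra. }
    pose proof (abel_nonneg w d n Hw0 Hdec Hd0) as H.
    assert (Hs : sum_n v n = sum_n u n + sum_n (fun k => w k * d k) n).
    { rewrite <- (sum_n_plus u (fun k => w k * d k)). apply sum_n_ext. intros k.
      unfold u, v, w, d, x. change (@plus R_AbelianMonoid) with Rplus.
      rewrite pow_mult, Rpow_mult_distr.
      change ((r ^ 2) ^ S k) with (r ^ 2 * (r ^ 2) ^ k). set (y := (r ^ 2) ^ k).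
      ring_carrier. }
    specialize (Hw0 n). specialize (Hd0 n). nra. }
  destruct (series_bounded u (Series v)) as [Hex Hle]; trivial.
  { intros n. apply Rle_trans with (1 := Huv n). apply sum_n_le_Series; trivial. eexists; exact Hv. }
  rewrite (is_series_unique _ _ Hv) in Hle. split; trivial.
  apply Rle_trans with (sum_n u 0); [rewrite sum_n_0_R; apply Hu0|]. now apply sum_n_le_Series.
Qed.

(** * The sharp constant as a minimum over one variable *)

(** The polynomial [phi] freed of a factor that has no root in the unit interval. *)
Definition psi (p : R) : R :=
  8 * p ^ 7 - 94 * p ^ 6 + 812 * p ^ 5 - 3712 * p ^ 4 + 9012 * p ^ 3
  - 11994 * p ^ 2 + 8208 * p - 2160.

Lemma phi_psi p : phi p = 81 * (3 - 2 * p) * psi p.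
Proof. unfold phi, psi. ring. Qed.

(** The constant that makes the inequality an equality for the disk
    automorphism with [|a_0| = p] at radius [1/(3-p)]. *)
Definition sharp_mu (p : R) : R :=
  81 * (54 - 39 * p + 6 * p ^ 2 - p ^ 3) * (3 - 2 * p) ^ 2
  / (8 * (2 - p) * (1 - p) * (1 + p) ^ 3 * (3 - p) ^ 4).

(** Expanded at [9/10] in powers of [x = 9/10 - p], all nonconstant
    coefficients of [psi] are negative. *)
Lemma psi_increasing p q : p < q <= 9 / 10 -> psi p < psi q.
Proof.
  intros H.
  assert (Hs : forall x, psi (9 / 10 - x) = 199284003 / 2500000 - (1695573 / 31250 * x
    + 15208467 / 25000 * x ^ 2 + 259797 / 250 * x ^ 3 + 49799 / 50 * x ^ 4
    + 11012 / 25 * x ^ 5 + 218 / 5 * x ^ 6 + 8 * x ^ 7)) by (intros; unfold psi; field).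
  replace p with (9 / 10 - (9 / 10 - p)) by ring.
  replace q with (9 / 10 - (9 / 10 - q)) by ring.
  rewrite !Hs. set (x := 9 / 10 - p). set (y := 9 / 10 - q).
  assert (Hxy : 0 <= y < x) by (unfold x, y; lra).
  assert (Hpow : forall k, y ^ k <= x ^ k) by (intros; apply pow_incr; lra).
  pose proof (Hpow 2%nat). pose proof (Hpow 3%nat). pose proof (Hpow 4%nat).
  pose proof (Hpow 5%nat). pose proof (Hpow 6%nat). pose proof (Hpow 7%nat). lra.
Qed.

Lemma psi_pos p : 9 / 10 <= p <= 1 -> 0 < psi p.
Proof.
  intros H.
  replace p with (1 - (1 - p)) by ring. set (x := 1 - p).
  assert (Hx : 0 <= x <= 1 / 10) by (unfold x; lra).
  replace (psi (1 - x)) with (80 + 40 * x - 352 * x ^ 2 - 684 * x ^ 3 - 782 * x ^ 4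
    - 416 * x ^ 5 - 38 * x ^ 6 - 8 * x ^ 7) by (unfold psi; ring).
  assert (Hpow : forall k, x ^ k <= (1 / 10) ^ k) by (intros; apply pow_incr; lra).
  pose proof (Hpow 2%nat). pose proof (Hpow 3%nat). pose proof (Hpow 4%nat).
  pose proof (Hpow 5%nat). pose proof (Hpow 6%nat). pose proof (Hpow 7%nat). lra.
Qed.

Lemma psi_root :
  exists t, 63830206275 / 10 ^ 11 <= t <= 63830206276 / 10 ^ 11 /\ psi t = 0.
Proof.
  destruct (IVT_gen psi (63830206275 / 10 ^ 11) (63830206276 / 10 ^ 11) 0) as (t & Ht & H0).
  - unfold psi. reg.
  - rewrite Rmin_left, Rmax_right; [unfold psi; lra| |]; unfold psi; lra.
  - rewrite Rmin_left, Rmax_right in Ht by lra. exists t. now split.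
Qed.

(** [psi] is increasing up to [9/10] and positive from there to 1; near 1 it
    is no longer monotone, hence the two regimes. *)
Lemma psi_sign t p :
  0 < t < 9 / 10 -> psi t = 0 -> 0 <= p <= 1 -> (p < t -> psi p < 0) /\ (t < p -> 0 < psi p).
Proof.
  intros Ht H0 Hp. split; intros Hpt.
  - rewrite <- H0. apply psi_increasing; lra.
  - destruct (Rle_dec p (9 / 10)).
    + rewrite <- H0. apply psi_increasing; lra.
    + apply psi_pos; lra.
Qed.

Lemma sharp_mu_derive p :
  0 <= p < 1 ->
  is_derive sharp_mu p
    (81 * (3 - 2 * p) * psi p
     / (8 * ((2 - p) ^ 2 * (1 - p) ^ 2 * (1 + p) ^ 4 * (3 - p) ^ 5))).
Proof.
  intros Hp. unfold sharp_mu. auto_derive.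
  - repeat apply Rmult_integral_contrapositive_currified; try apply pow_nonzero; lra.
  - unfold psi. field. repeat split; lra.
Qed.

(** The derivative of [sharp_mu] has the sign of [psi], negative before [t]
    and positive after it. *)
Lemma sharp_mu_min t p :
  0 < t < 9 / 10 -> psi t = 0 -> 0 <= p < 1 -> sharp_mu t <= sharp_mu p.
Proof.
  intros Ht H0 Hp.
  destruct (MVT_gen sharp_mu t p (fun p => 81 * (3 - 2 * p) * psi p
     / (8 * ((2 - p) ^ 2 * (1 - p) ^ 2 * (1 + p) ^ 4 * (3 - p) ^ 5)))) as (c & Hc & Heq).
  - intros x Hx. apply sharp_mu_derive.
    unfold Rmin, Rmax in Hx. destruct (Rle_dec t p); lra.
  - intros x Hx. apply continuity_pt_filterlim.
    apply (ex_derive_continuous (K := R_AbsRing) (V := R_NormedModule)).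
    eexists. apply sharp_mu_derive. unfold Rmin, Rmax in Hx. destruct (Rle_dec t p); lra.
  - enough (0 <= sharp_mu p - sharp_mu t) by lra. rewrite Heq.
    assert (Hc1 : 0 <= c < 1) by (unfold Rmin, Rmax in Hc; destruct (Rle_dec t p); lra).
    set (W := 8 * ((2 - c) ^ 2 * (1 - c) ^ 2 * (1 + c) ^ 4 * (3 - c) ^ 5)).
    assert (HW : 0 < W).
    { unfold W. repeat apply Rmult_lt_0_compat; try apply pow_lt; lra. }
    replace (81 * (3 - 2 * c) * psi c / W * (p - t))
      with (81 * (3 - 2 * c) / W * (psi c * (p - t))) by (field; lra).
    apply Rmult_le_pos; [apply Rdiv_le_0_compat; lra|].
    destruct (psi_sign t c Ht H0 ltac:(lra)) as [Hneg Hpos].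
    unfold Rmin, Rmax in Hc.
    destruct (Rle_dec t p) as [Hle|Hgt].
    + destruct (Rle_lt_or_eq_dec t c) as [Hlt|Heqc]; [lra| |].
      * specialize (Hpos Hlt). nra.
      * rewrite <- Heqc, H0. lra.
    + destruct (Rle_lt_or_eq_dec c t) as [Hlt|Heqc]; [lra| |].
      * specialize (Hneg Hlt). nra.
      * rewrite Heqc, H0. lra.
Qed.

(** The two expressions differ by [81 (3 - 2 t) psi t] over a common
    denominator. *)
Lemma mu_of_root t :
  3 / 5 <= t <= 7 / 10 -> psi t = 0 -> mu_of t = sharp_mu t.
Proof.
  intros Ht H0.
  assert (HK : 0 < 9 * t ^ 3 - 33 * t ^ 2 + 29 * t - 1) by nra.
  symmetry. apply Rminus_diag_uniq.
  transitivity (81 * (3 - 2 * t) * psi t / (8 * (1 + t) ^ 2 * (3 - t) ^ 3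
    * ((2 - t) * (1 - t) * (1 + t) * (3 - t)) * (9 * t ^ 3 - 33 * t ^ 2 + 29 * t - 1))).
  - unfold sharp_mu, mu_of, psi. field. repeat split; lra.
  - rewrite H0. unfold Rdiv. ring.
Qed.

(** At this root [mu_of] has slope about -25 and the tolerance leaves room
    of about [5/10^7], so [t] must be known to about [10^-8].  The powers of
    [t] are enclosed separately, which makes the numerator and the expanded
    denominator [d] linear in the enclosed quantities. *)
Lemma mu_of_approx t :
  63830206275 / 10 ^ 11 <= t <= 63830206276 / 10 ^ 11 ->
  Rabs (mu_of t - 13966088 / 10 ^ 6) <= 2 / 10 ^ 6.
Proof.
  intros Ht.
  set (lo := 63830206275 / 10 ^ 11) in *. set (hi := 63830206276 / 10 ^ 11) in *.
  assert (Hpow : forall k, lo ^ k <= t ^ k <= hi ^ k).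
  { intros k. assert (0 < lo) by (unfold lo; lra). split; apply pow_incr; lra. }
  pose proof (Hpow 2%nat) as H2. pose proof (Hpow 3%nat) as H3. pose proof (Hpow 4%nat) as H4.
  pose proof (Hpow 5%nat) as H5. pose proof (Hpow 6%nat) as H6. pose proof (Hpow 7%nat) as H7.
  pose proof (Hpow 8%nat) as H8. clear Hpow.
  set (n := - 80919 + 119556 * t - 57591 * t ^ 2 + 11664 * t ^ 3 - 1620 * t ^ 4).
  set (d := 216 - 6048 * t + 720 * t ^ 2 + 9280 * t ^ 3 - 4320 * t ^ 4 - 2976 * t ^ 5
    + 2800 * t ^ 6 - 768 * t ^ 7 + 72 * t ^ 8).
  assert (Hmu : mu_of t = n / d).
  { unfold mu_of, n, d. f_equal. ring. }
  unfold lo, hi in *.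
  assert (Hd : d < 0) by (unfold d; lra).
  assert (Hup : (13966088 + 2) / 10 ^ 6 * d <= n) by (unfold n, d; lra).
  assert (Hlo : n <= (13966088 - 2) / 10 ^ 6 * d) by (unfold n, d; lra).
  rewrite Hmu. set (m := n / d). assert (Hm : n = m * d) by (unfold m; field; lra).
  rewrite Hm in Hup, Hlo. apply Rabs_le. split; nra.
Qed.

(** This is where [sharp_mu] comes from: the equation
    [1 - p^2 - (1-p^2)/(2-p) - 9/8 G = mu G^2] solved for [mu]. *)
Lemma extremal_identity p :
  0 <= p < 1 ->
  let r := 1 / (3 - p) in
  let G := (1 - p ^ 2) ^ 2 * r ^ 2 / (1 - p ^ 2 * r ^ 2) ^ 2 in
  p ^ 2 + (1 - p ^ 2) * (r / (1 - r)) + 9 / 8 * G + sharp_mu p * G ^ 2 = 1.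
Proof.
  intros Hp r G.
  assert (HG : G = (1 - p ^ 2) ^ 2 * (3 - p) ^ 2 / (9 - 6 * p) ^ 2).
  { unfold G, r. field. repeat split; lra. }
  assert (Hr : r / (1 - r) = 1 / (2 - p)) by (unfold r; field; lra).
  rewrite HG, Hr. unfold sharp_mu. field. repeat split; lra.
Qed.

(** * The extremal function and the main theorem *)

(** The Taylor coefficients of [(t - z)/(1 - t z)]. *)
Definition mobius_coef (t : R) (k : nat) : C :=
  match k with O => RtoC t | S k => RtoC (- ((1 - t ^ 2) * t ^ k)) end.

Lemma mobius_denominator t z : 0 <= t < 1 -> Cmod z < 1 -> (1 - RtoC t * z)%C <> 0.
Proof.
  intros Ht Hz E.
  assert (H1 : Cmod (RtoC t * z)%C = 1).
  { replace (RtoC t * z)%C with (1 - (1 - RtoC t * z))%C by ring. rewrite E.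
    replace (1 - 0)%C with (RtoC 1) by ring. apply Cmod_1. }
  rewrite Cmod_mult, Cmod_RtoC_nonneg in H1 by lra.
  pose proof (Cmod_ge_0 z). nra.
Qed.

(** Multiplying by the denominator telescopes the geometric part, leaving an
    explicit remainder that tends to 0 on the disk. *)
Lemma mobius_partial_sum t z n :
  (cpoly (mobius_coef t) n z * (1 - RtoC t * z)
   = (RtoC t - z) + RtoC (1 - t ^ 2) * RtoC (t ^ n) * z ^ S n)%C.
Proof.
  induction n as [|n IH].
  - unfold cpoly. rewrite sum_n_0_C, RtoC_minus, !RtoC_pow. simpl. ring.
  - unfold cpoly. rewrite sum_n_S_C. fold (cpoly (mobius_coef t) n z).
    rewrite Cmult_plus_distr_r, IH. change (mobius_coef t (S n)) with (RtoC (- ((1 - t ^ 2) * t ^ n))).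
    rewrite RtoC_opp, RtoC_mult, RtoC_minus, !RtoC_pow, !Cpow_S. ring.
Qed.

Lemma mobius_expansion t :
  0 <= t < 1 -> disk_expansion (disk_automorphism t) (mobius_coef t).
Proof.
  intros Ht z Hz. pose proof (mobius_denominator t z Ht Hz) as Hne.
  apply filterlim_ext with (fun n => cpoly (mobius_coef t) n z).
  { intros n. symmetry. apply pseries_partial_sums. }
  apply (filterlim_locally_ball_norm (K := C_AbsRing) (U := C_NormedModule)). intros eps.
  set (K := (1 - t ^ 2) / Cmod (1 - RtoC t * z)%C).
  assert (HD : 0 < Cmod (1 - RtoC t * z)%C) by now apply Cmod_gt_0.
  assert (HK : 0 <= K) by (apply Rdiv_le_0_compat; [nra|trivial]).
  assert (Hlim : is_lim_seq (fun n => K * t ^ n) 0).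
  { replace (Finite 0) with (Rbar_mult K 0) by (simpl; now rewrite Rmult_0_r).
    apply is_lim_seq_scal_l, is_lim_seq_geom. rewrite Rabs_pos_eq; lra. }
  apply is_lim_seq_spec in Hlim. destruct (Hlim eps) as [N HN].
  exists N. intros n Hn. specialize (HN n Hn). rewrite Rminus_0_r in HN.
  apply Rabs_def2 in HN.
  change (Cmod (cpoly (mobius_coef t) n z - disk_automorphism t z)%C < eps).
  replace (cpoly (mobius_coef t) n z - disk_automorphism t z)%C
    with (RtoC (1 - t ^ 2) * RtoC (t ^ n) * z ^ S n / (1 - RtoC t * z))%C.
  - rewrite Cmod_div, !Cmod_mult, Cmod_pow, !Cmod_RtoC_nonneg; trivial; try apply pow_le; try nra.
    apply Rle_lt_trans with (K * t ^ n); [|lra].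
    replace ((1 - t ^ 2) * t ^ n * Cmod z ^ S n / Cmod (1 - RtoC t * z)%C)
      with (K * t ^ n * Cmod z ^ S n) by (unfold K; field; lra).
    assert (0 <= K * t ^ n) by (apply Rmult_le_pos; [trivial|apply pow_le; lra]).
    assert (Cmod z ^ S n <= 1).
    { rewrite <- (pow1 (S n)). apply pow_incr. pose proof (Cmod_ge_0 z). lra. }
    nra.
  - assert (Hp : cpoly (mobius_coef t) n z = ((RtoC t - z
        + RtoC (1 - t ^ 2) * RtoC (t ^ n) * z ^ S n) / (1 - RtoC t * z))%C).
    { rewrite <- mobius_partial_sum. field. trivial. }
    rewrite Hp. unfold disk_automorphism. field. trivial.
Qed.

(** [|1 - t z|^2 - |t - z|^2 = (1 - t^2)(1 - |z|^2)]. *)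
Lemma mobius_bounded t : 0 <= t < 1 -> bounded_on_disk (disk_automorphism t).
Proof.
  intros Ht z Hz. pose proof (mobius_denominator t z Ht Hz) as Hne.
  unfold disk_automorphism. rewrite Cmod_div by trivial.
  apply Cmod_gt_0 in Hne. apply Rle_div_l; [trivial|]. rewrite Rmult_1_l.
  apply le_of_sq_le; [lra|].
  assert (Hz2 : Cmod z ^ 2 <= 1).
  { pose proof (Cmod_ge_0 z). nra. }
  rewrite Cmod2_alt in Hz2 |- *; rewrite Cmod2_alt. destruct z as [x y]. simpl in *.
  replace (x * (x * 1) + y * (y * 1)) with (x ^ 2 + y ^ 2) in Hz2 by ring.
  assert (0 <= (1 - t ^ 2) * (1 - (x ^ 2 + y ^ 2))) by (apply Rmult_le_pos; nra). lra.
Qed.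

Lemma Cmod_mobius_coef t k : 0 <= t < 1 -> Cmod (mobius_coef t (S k)) = (1 - t ^ 2) * t ^ k.
Proof.
  intros Ht. simpl mobius_coef. rewrite RtoC_opp, Cmod_opp. apply Cmod_RtoC_nonneg.
  apply Rmult_le_pos; [nra|apply pow_le; lra].
Qed.

Lemma scaled_geometric_Series c x : 0 <= x < 1 -> Series (fun k => c * x ^ k) = c / (1 - x).
Proof.
  intros Hx. rewrite Series_scal_l, Series_geom; [reflexivity|]. rewrite Rabs_pos_eq; lra.
Qed.

(** Equality in the majorant bound, with the area bound attained as well. *)
Lemma mobius_bohr_lhs mu t r :
  0 <= t < 1 -> 0 <= r < 1 ->
  let G := (1 - t ^ 2) ^ 2 * r ^ 2 / (1 - t ^ 2 * r ^ 2) ^ 2 in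
  bohr_lhs mu (mobius_coef t) r
  = t ^ 2 + (1 - t ^ 2) * (r / (1 - r)) + 9 / 8 * G + mu * G ^ 2.
Proof.
  intros Ht Hr G.
  assert (Htr : 0 <= t * r < 1) by nra.
  assert (Hx : 0 <= t ^ 2 * r ^ 2 < 1).
  { replace (t ^ 2 * r ^ 2) with ((t * r) * (t * r)) by ring. nra. }
  assert (HM : majorant0 (mobius_coef t) r = (1 - t ^ 2) * r / (1 - t * r)).
  { unfold majorant0. rewrite <- scaled_geometric_Series by trivial.
    apply Series_ext. intros k. rewrite Cmod_mobius_coef, Rpow_mult_distr by trivial. simpl. ring. }
  assert (HN : norm0_sq (mobius_coef t) r = (1 - t ^ 2) ^ 2 * r ^ 2 / (1 - t ^ 2 * r ^ 2)).
  { unfold norm0_sq. rewrite <- scaled_geometric_Series by trivial.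
    apply Series_ext. intros k. rewrite Cmod_mobius_coef by trivial.
    rewrite !Rpow_mult_distr, <- !pow_mult, (Nat.mul_comm k 2).
    replace (2 * S k)%nat with (2 + 2 * k)%nat by lia. rewrite pow_add. ring. }
  assert (HA : image_area (mobius_coef t) r / PI = G).
  { unfold image_area.
    rewrite (Series_ext _ (fun k => (1 - t ^ 2) ^ 2 * r ^ 2 * (INR (S k) * (t ^ 2 * r ^ 2) ^ k))).
    - rewrite Series_scal_l, (is_series_unique _ _ (is_series_arith_geom _ Hx)).
      unfold G. field. split; [lra|apply PI_neq0].
    - intros k. rewrite Cmod_mobius_coef by trivial.
      rewrite !Rpow_mult_distr, <- !pow_mult, (Nat.mul_comm k 2).
      replace (2 * S k)%nat with (2 + 2 * k)%nat by lia. rewrite pow_add. ring. }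
  unfold bohr_lhs. rewrite HM, HN, HA. simpl mobius_coef. rewrite Cmod_RtoC_nonneg by lra.
  do 2 f_equal.
  replace (1 - t ^ 2 * r ^ 2) with ((1 - t * r) * (1 + t * r)) by ring.
  field. repeat split; lra.
Qed.

(** Any nonnegative constant below all values of [sharp_mu] works.  The
    bounds are monotone in [r], and at [r = 1/(3-p)] they are compared with
    [extremal_identity]; [p = 1] is separate because [sharp_mu] has a pole
    there, but then the area bound vanishes. *)
Lemma bohr_inequality mu f a r :
  0 <= mu -> (forall p, 0 <= p < 1 -> mu <= sharp_mu p) ->
  disk_expansion f a -> bounded_on_disk f ->
  0 <= r <= 1 / (3 - Cmod (a 0%nat)) ->
  bohr_lhs mu a r <= 1.
Proof.
  intros Hmu0 Hmu Hf Hb Hr.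
  pose proof (disk_contraction f a Hf Hb) as Ha.
  set (p := Cmod (a 0%nat)) in *. assert (Hp : 0 <= p) by apply Cmod_ge_0.
  assert (Hp1 : p <= 1).
  { pose proof (energy_le_1 a 0 Ha) as H. unfold energy in H. rewrite sum_n_0_R in H.
    fold p in H. nra. }
  set (R0 := 1 / (3 - p)) in *.
  assert (HR : R0 <= 1 / 2).
  { unfold R0. apply Rle_div_l; lra. }
  assert (Hr1 : 0 <= r < 1) by lra.
  pose proof (majorant_bound a r Ha Hr1) as HM. cbv zeta in HM. fold p in HM.
  pose proof (area_bound a r Ha ltac:(lra)) as HS. cbv zeta in HS. fold p in HS.
  unfold bohr_lhs. fold p. set (A := image_area a r / PI) in *.
  set (G := (1 - p ^ 2) ^ 2 * R0 ^ 2 / (1 - p ^ 2 * R0 ^ 2) ^ 2).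
  assert (Hp2 : 0 <= p ^ 2 <= 1) by nra.
  assert (HpR : p ^ 2 * R0 ^ 2 <= 1 / 4) by nra.
  assert (Hpr : p ^ 2 * r ^ 2 <= p ^ 2 * R0 ^ 2) by (apply Rmult_le_compat_l; nra).
  assert (HG : (1 - p ^ 2) ^ 2 * r ^ 2 / (1 - p ^ 2 * r ^ 2) ^ 2 <= G).
  { unfold G, Rdiv. apply Rmult_le_compat.
    - apply Rmult_le_pos; apply pow2_ge_0.
    - left. apply Rinv_0_lt_compat, pow_lt. lra.
    - apply Rmult_le_compat_l; [apply pow2_ge_0|nra].
    - apply Rinv_le_contravar; [apply pow_lt; lra|apply pow_incr; lra]. }
  assert (HA : 0 <= A <= G) by lra.
  assert (Hrr : r / (1 - r) <= R0 / (1 - R0)).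
  { unfold Rdiv. apply Rmult_le_compat; try lra.
    - left. apply Rinv_0_lt_compat. lra.
    - apply Rinv_le_contravar; lra. }
  assert (HcR : (1 - p ^ 2) * (r / (1 - r)) <= (1 - p ^ 2) * (R0 / (1 - R0)))
    by (apply Rmult_le_compat_l; lra).
  assert (HAG : mu * A ^ 2 <= mu * G ^ 2) by (apply Rmult_le_compat_l; [trivial|nra]).
  enough (p ^ 2 + (1 - p ^ 2) * (R0 / (1 - R0)) + 9 / 8 * G + mu * G ^ 2 <= 1) by lra.
  destruct (Rle_lt_or_eq_dec p 1 Hp1) as [Hlt|Heq].
  - pose proof (extremal_identity p ltac:(lra)) as Hid. cbv zeta in Hid. fold R0 G in Hid.
    pose proof (Hmu p ltac:(lra)). pose proof (pow2_ge_0 G). nra.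
  - assert (HG0 : G = 0) by (unfold G; rewrite Heq; unfold Rdiv; ring).
    rewrite HG0, Heq. lra.
Qed.

Theorem theorem2 :
  exists t : R,
    unique (fun s : R => 0 < s < 1 /\ phi s = 0) t
    /\ Rabs (t - 638302 / 10 ^ 6) <= 1 / 2 / 10 ^ 6
    /\ Rabs (mu_of t - 13966088 / 10 ^ 6) <= 2 / 10 ^ 6
    /\ (forall (f : C -> C) (a : nat -> C),
          disk_expansion f a ->
          bounded_on_disk f ->
          forall r : R, 0 <= r <= 1 / (3 - Cmod (a 0%nat)) ->
            bohr_lhs (mu_of t) a r <= 1)
    /\ (exists a : nat -> C,
          disk_expansion (disk_automorphism t) a
          /\ bounded_on_disk (disk_automorphism t)
          /\ bohr_lhs (mu_of t) a (1 / (3 - t)) = 1).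
Proof.
  destruct psi_root as (t & Ht & H0).
  assert (Ht1 : 3 / 5 <= t <= 7 / 10) by lra.
  assert (Htd : 0 <= t < 1) by lra.
  pose proof (mu_of_approx t Ht) as Hmu.
  pose proof (mu_of_root t Ht1 H0) as Hsharp.
  exists t. split; [|split; [|split; [|split]]]; trivial.
  - split.
    + split; [lra|]. rewrite phi_psi, H0. ring.
    + intros s [Hs Hphi]. rewrite phi_psi in Hphi.
      assert (Hpsi : psi s = 0).
      { apply Rmult_integral in Hphi. destruct Hphi; lra. }
      destruct (psi_sign t s ltac:(lra) H0 ltac:(lra)) as [Hneg Hpos].
      destruct (Rtotal_order s t) as [Hlt|[Heq|Hgt]]; [specialize (Hneg Hlt); lra|now symmetry|].
      specialize (Hpos Hgt). lra.
  - apply Rabs_le. lra.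
  - intros f a Hf Hb r Hr. apply (bohr_inequality (mu_of t) f); trivial.
    + apply Rabs_le_between in Hmu. lra.
    + intros p Hp. rewrite Hsharp. apply sharp_mu_min; trivial; lra.
  - exists (mobius_coef t). split; [now apply mobius_expansion|].
    split; [now apply mobius_bounded|].
    assert (Hr : 0 <= 1 / (3 - t) < 1).
    { split; [apply Rdiv_le_0_compat; lra|]. apply Rlt_div_l; lra. }
    rewrite mobius_bohr_lhs, Hsharp by trivial. now apply extremal_identity.
Qed.
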